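(* Let $(N,w)$ be a cooperative interval game. Then $(N,w)$ is selection monotonic if and only if for every $S,T \in 2^N$ with $S \subsetneq T$ we have $$\overline{w}(S) \le \underline{w}(T).$$
   Context: Let $N=\{1,2,\ldots,n\}$ be a set of players, let $2^N$ be the power set of $N$, and let $\mathbb{IR}$ be the set of all closed real intervals $X=[\underline{X},\overline{X}]=\{x\in\mathbb{R}: \underline{X}\le x\le \overline{X}\}$. A (classical) cooperative game is a pair $(N,v)$ with $v:2^N\to\mathbb{R}$ and $v(\emptyset)=0$. A cooperative interval game is a pair $(N,w)$ with $w:2^N\to\mathbb{IR}$ and $w(\emptyset)=[0,0]$. Write $\underline{w}(S)$ and $\overline{w}(S)$ for the lower and upper bound of the interval $w(S)$. A selection of $(N,w)$ is a cooperative game $(N,v)$ with $v(S)\in w(S)$ for every $S\in 2^N$. A cooperative game $(N,v)$ is monotonic if $v(T)\le v(S)$ for every $T\subseteq S\subseteq N$. An interval game is selection monotonic if all its selections are monotonic games. *)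

(* Defs.v *)
From HB Require Import structures.
From mathcomp Require Import all_boot all_order all_algebra reals.

Set Implicit Arguments.
Unset Strict Implicit.
Unset Printing Implicit Defensive.

Import Order.TTheory GRing.Theory Num.Theory.
Local Open Scope ring_scope.

(* Closed real intervals are nonempty: lower and upper bounds are well defined
   only under [lower <= upper]. *)
Record closed_interval (R : realType) := ClosedInterval {
  lower : R;
  upper : R;
  lower_le_upper : lower <= upper }.

Definition to_itv (R : realType) (X : closed_interval R) : interval R :=
  `[lower X, upper X].

Definition point_interval (R : realType) (x : R) : closed_interval R :=
  ClosedInterval (lexx x).

(* The player set {1, ..., n} is rendered as 'I_n = {0, ..., n-1}, and
   coalitions as {set 'I_n}. *)
Record coop_game (R : realType) (n : nat) := CoopGame {
  worth :> {set 'I_n} -> R;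
  worth_set0 : worth set0 = 0 }.

Record interval_game (R : realType) (n : nat) := IntervalGame {
  iworth :> {set 'I_n} -> closed_interval R;
  iworth_set0 : iworth set0 = point_interval 0 }.

Definition selection (R : realType) (n : nat)
    (w : interval_game R n) (v : coop_game R n) : Prop :=
  forall S : {set 'I_n}, v S \in to_itv (w S).

Definition monotonic (R : realType) (n : nat) (v : coop_game R n) : Prop :=
  forall S T : {set 'I_n}, T \subset S -> v T <= v S.

Definition selection_monotonic (R : realType) (n : nat)
    (w : interval_game R n) : Prop :=
  forall v : coop_game R n, selection w v -> monotonic v.

(* Main.v *)
Require Import Defs.
From mathcomp Require Import all_boot all_order all_algebra reals.

Set Implicit Arguments.
Unset Strict Implicit.
Unset Printing Implicit Defensive.

Import Order.TTheory GRing.Theory Num.Theory.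
Local Open Scope ring_scope.

(** Necessity tests a single worst-case selection: the upper bound at [S], lower bounds elsewhere;
    its monotonicity from [S] to [T] is the required inequality. Sufficiency chains
    [v T <= upper (w T) <= lower (w S) <= v S]. *)

Theorem theorem2 (R : realType) (n : nat) (w : interval_game R n) :
  selection_monotonic w <->
  forall S T : {set 'I_n}, S \proper T -> upper (w S) <= lower (w T).
Proof.
split=> [w_mono S T ltST | w_sep v v_sel S T sTS].
  pose f X := if X == S then upper (w X) else lower (w X).
  (* Both branches give 0 as [w set0] is degenerate, so [S = set0] needs no separate case. *)
  have f0 : f set0 = 0 by rewrite /f iworth_set0 /= if_same.
  have f_sel : selection w (CoopGame f0).
    move=> X; rewrite /to_itv in_itv /= /f.
    by case: ifP => _; rewrite lexx lower_le_upper.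
  have := w_mono _ f_sel T S (proper_sub ltST).
  by rewrite /= /f eqxx eq_sym (negbTE (proper_neq ltST)).
(* [w_sep] covers only proper inclusions. Here [T] is the smaller coalition. *)
have [->//|neTS] := eqVneq T S.
have ltTS : T \proper S by rewrite properEneq neTS.
have := v_sel T; have := v_sel S.
rewrite /to_itv !in_itv /= => /andP[lowS _] /andP[_ uppT].
exact: le_trans uppT (le_trans (w_sep _ _ ltTS) lowS).
Qed.
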